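(* Let $F$ be a field of characteristic $\ne 2$, and let $\mathcal M$ be a $3\times 7$ matrix over $F$ whose $3\times 3$ minors $d_{ijk}$ are nonzero for all pairwise different $i,j,k\in\{1,\dots,7\}$. Then the scalar products $\langle\cdot,\cdot\rangle_5^{(p)}$, $p=1,\dots,7$, determined by $$\langle e_{ij},e_{kl}\rangle_5^{(p)}=\det\eta_p\cdot\left(d_{ikp}d_{jlp}+d_{ilp}d_{jkp}\right),$$ define a (quadratic) 5-cocycle: $$\sum_{p=1}^7(-1)^p\,\langle e_{ij},e_{kl}\rangle_5^{(p)}=0$$ for any two edges $ij$ and $kl$ of the 6-simplex with vertices $1,\dots,7$.
   Context: Let the columns of $\mathcal M$ be $(\alpha_i,\beta_i,\gamma_i)^{T}$, $i=1,\dots,7$, and let $d_{ijk}$ be the determinant of the $3\times3$ matrix whose columns are columns $i,j,k$ of $\mathcal M$, in this order (so $d_{ijk}=0$ if two indices coincide). Simplices. Consider the 6-simplex $\Delta^6$ with vertices $1,\dots,7$. For $p\in\{1,\dots,7\}$, ''5-simplex $p$'' is the 5-face of $\Delta^6$ with all vertices except $p$. For $i\ne p$, ''4-face $ip$'' (the same as $pi$) is the 4-face with all vertices except $i$ and $p$; the 4-faces of 5-simplex $p$ are the six faces $ip$, $i\neq p$. An edge $ij$ is an unordered pair of distinct vertices; two edges $ij$ and $kl$ may share vertices or coincide. Colorings. A coloring of 5-simplex $p$ is an assignment of an element $x_{ip}\in F$ to each of its 4-faces $ip$, $i\neq p$. It is permitted if for pairwise different $i,j,k,l\in\{1,\dots,7\}\setminus\{p\}$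 $$x_{lp}=\frac{d_{jlp}d_{klp}}{d_{ijp}d_{ikp}}\,x_{ip}+\frac{d_{ilp}d_{klp}}{d_{jip}d_{jkp}}\,x_{jp}+\frac{d_{ilp}d_{jlp}}{d_{kip}d_{kjp}}\,x_{kp}$$ (faces $ip,jp,kp$ are ''inputs'' and the other three faces $lp$ are ''outputs''; imposing this for one fixed triple of inputs and all three outputs $l$ is equivalent to imposing it for all triples). A permitted coloring of $\Delta^6$ is an assignment of $x_{ip}=x_{pi}\in F$ to all 21 4-faces whose restriction to each 5-simplex $p$ is permitted. Edge vectors. For an edge $ij$, the edge vector $e_{ij}$ is the permitted coloring of $\Delta^6$ whose component on the 4-face $lm$ is $e_{ij}|_{lm}=d_{ilm}d_{jlm}$. The edge vectors span the space of permitted colorings of $\Delta^6$, and their restrictions to 5-simplex $p$ span the (3-dimensional) space of permitted colorings of 5-simplex $p$. Matrix $\eta_p$. $\eta_p$ is the $6\times6$ matrix whose columns are $(\alpha_q^2,\ \beta_q^2,\ \gamma_q^2,\ \alpha_q\beta_q,\ \alpha_q\gamma_q,\ \beta_q\gamma_q)^T$ for $q\in\{1,\dots,7\}\setminus\{p\}$, taken in increasing order of $q$. Scalar products. $\langle\cdot,\cdot\rangle_5^{(p)}$ is the symmetric bilinear form on the space of permitted colorings of 5-simplex $p$ whose value on the restrictions of $e_{ij}$ and $e_{kl}$ to 5-simplex $p$ is given by the formula in the claim (this form is well defined; if $p$ belongs to one of the edges, both the restriction of that edge vector to 5-simplex $p$ and the right-hand side vanish). Cocycles. A quadratic 5-cochain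 is a 7-tuple of quadratic forms, one on the space of permitted colorings of each 5-simplex $p$; via polarization it is the same as a 7-tuple of symmetric bilinear forms $B_p$. It is a 5-cocycle if $\sum_{p=1}^7(-1)^pB_p(x|_p,y|_p)=0$ for all permitted colorings $x,y$ of $\Delta^6$, where $x|_p$ denotes the restriction to 5-simplex $p$. *)

(* Defs.v *)
From HB Require Import structures.
From mathcomp Require Import all_boot all_order all_algebra.
From mathcomp Require Import ring.

Set Implicit Arguments.
Unset Strict Implicit.
Unset Printing Implicit Defensive.
Import GRing.Theory.
Local Open Scope ring_scope.

(* Vertices 1, ..., 7 are represented by the ordinals 0, ..., 6. *)

(* The 4-faces ip of 5-simplex p, each given by its second missing vertex i. *)
Definition face5 (p : 'I_7) := {i : 'I_7 | i != p}.

(* Ordered pairs lm of distinct vertices.  Each 4-face of the 6-simplex occurs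
   twice, as lm and as ml; colorings are required to agree on the two. *)
Definition face6 := {u : 'I_7 * 'I_7 | u.1 != u.2}.

Definition mkface6 (l m : 'I_7) (lm : l != m) : face6 :=
  exist (fun u : 'I_7 * 'I_7 => u.1 != u.2) (l, m) lm.

Definition minor (F : fieldType) (M : 'M[F]_(3, 7)) (i j k : 'I_7) : F :=
  \det (colsub (tnth [tuple i; j; k]) M).

Definition nonzero_minors (F : fieldType) (M : 'M[F]_(3, 7)) : Prop :=
  forall i j k : 'I_7, uniq [:: i; j; k] -> minor M i j k != 0.

Definition coloring5 (F : fieldType) (p : 'I_7) := {ffun face5 p -> F^o}.

Definition coloring6 (F : fieldType) := {ffun face6 -> F^o}.

Definition restr (F : fieldType) (p : 'I_7) (x : coloring6 F) : coloring5 F p :=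
  [ffun i : face5 p => x (mkface6 (valP i))].

Definition is_permitted5 (F : fieldType) (M : 'M[F]_(3, 7)) (p : 'I_7) :
    {pred coloring5 F p} :=
  let d i j := minor M i j p in
  fun x =>
  [forall i : face5 p, forall j : face5 p, forall k : face5 p,
   forall l : face5 p, uniq [:: i; j; k; l] ==>
    (x l ==
       d (val j) (val l) * d (val k) (val l)
         / (d (val i) (val j) * d (val i) (val k)) * x i
     + d (val i) (val l) * d (val k) (val l)
         / (d (val j) (val i) * d (val j) (val k)) * x j
     + d (val i) (val l) * d (val j) (val l)
         / (d (val k) (val i) * d (val k) (val j)) * x k)].

Arguments is_permitted5 {F} M p.

Definition is_permitted6 (F : fieldType) (M : 'M[F]_(3, 7)) :
    {pred coloring6 F} :=
  fun x =>
  [forall u : face6, forall v : face6,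
     (val v == ((val u).2, (val u).1)) ==> (x u == x v)]
  && [forall p : 'I_7, restr p x \in is_permitted5 M p].

Arguments is_permitted6 {F} M.

Lemma is_permitted5P (F : fieldType) (M : 'M[F]_(3, 7)) (p : 'I_7)
    (x : coloring5 F p) :
  reflect (forall i j k l : face5 p, uniq [:: i; j; k; l] ->
    x l =
       minor M (val j) (val l) p * minor M (val k) (val l) p
         / (minor M (val i) (val j) p * minor M (val i) (val k) p) * x i
     + minor M (val i) (val l) p * minor M (val k) (val l) p
         / (minor M (val j) (val i) p * minor M (val j) (val k) p) * x j
     + minor M (val i) (val l) p * minor M (val j) (val l) p
         / (minor M (val k) (val i) p * minor M (val k) (val j) p) * x k)
   (x \in is_permitted5 M p).
Proof.
apply: (iffP forallP) => [h i j k l u | h i].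
  by have /forallP/(_ j)/forallP/(_ k)/forallP/(_ l)/implyP/(_ u)/eqP := h i.
by do 3!apply/forallP => ?; apply/implyP => u; apply/eqP/h.
Qed.

Lemma is_permitted6P (F : fieldType) (M : 'M[F]_(3, 7)) (x : coloring6 F) :
  reflect ((forall l m (lm : l != m) (ml : m != l),
              x (mkface6 lm) = x (mkface6 ml))
           /\ forall p, restr p x \in is_permitted5 M p)
          (x \in is_permitted6 M).
Proof.
apply: (iffP andP) => [] [h1 /forallP h2]; split=> //.
- move=> l m lm ml; move/forallP/(_ (mkface6 lm)): h1.
  by move/forallP/(_ (mkface6 ml)); rewrite /= eqxx => /eqP.
- apply/forallP=> -[[l m] lm]; apply/forallP=> -[[l' m'] ml].
  by apply/implyP => /eqP /= [e1 e2]; subst l' m'; apply/eqP/h1.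
Qed.

Lemma restr_lin (F : fieldType) (p : 'I_7) (a : F) (x y : coloring6 F) :
  restr p (a *: x + y) = a *: restr p x + restr p y.
Proof. by apply/ffunP => i; rewrite !ffunE. Qed.

Lemma is_permitted5_submod (F : fieldType) (M : 'M[F]_(3, 7)) (p : 'I_7) :
  GRing.submod_closed (is_permitted5 M p).
Proof.
split; first by apply/is_permitted5P => i j k l _; rewrite !ffunE !mulr0 !addr0.
move=> a x y /is_permitted5P hx /is_permitted5P hy.
apply/is_permitted5P => i j k l u; rewrite !ffunE (hx _ _ _ _ u) (hy _ _ _ _ u).
by rewrite /GRing.scale /=; ring.
Qed.

HB.instance Definition _ (F : fieldType) (M : 'M[F]_(3, 7)) (p : 'I_7) :=
  GRing.isSubmodClosed.Build F (coloring5 F p) (is_permitted5 M p)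
    (is_permitted5_submod M p).

Lemma is_permitted6_submod (F : fieldType) (M : 'M[F]_(3, 7)) :
  GRing.submod_closed (is_permitted6 M).
Proof.
split.
  apply/is_permitted6P; split=> [l m lm ml|p]; first by rewrite !ffunE.
  by have -> : restr p 0 = 0 :> coloring5 F p; rewrite ?rpred0 //;
     apply/ffunP=> i; rewrite !ffunE.
move=> a x y /is_permitted6P[sx hx] /is_permitted6P[sy hy].
apply/is_permitted6P; split=> [l m lm ml|p].
  by rewrite !ffunE (sx _ _ lm ml) (sy _ _ lm ml).
rewrite restr_lin; apply: rpredD; first apply: rpredZ.
  exact: hx.
exact: hy.
Qed.

HB.instance Definition _ (F : fieldType) (M : 'M[F]_(3, 7)) :=
  GRing.isSubmodClosed.Build F (coloring6 F) (is_permitted6 M)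
    (is_permitted6_submod M).

Record permitted5 (F : fieldType) (M : 'M[F]_(3, 7)) (p : 'I_7) := Permitted5 {
  coloring_of5 :> coloring5 F p;
  _ : coloring_of5 \in is_permitted5 M p }.

HB.instance Definition _ (F : fieldType) (M : 'M[F]_(3, 7)) (p : 'I_7) :=
  [isSub for @coloring_of5 F M p].
HB.instance Definition _ (F : fieldType) (M : 'M[F]_(3, 7)) (p : 'I_7) :=
  [Choice of permitted5 M p by <:].
HB.instance Definition _ (F : fieldType) (M : 'M[F]_(3, 7)) (p : 'I_7) :=
  [SubChoice_isSubLmodule of permitted5 M p by <:].

Record permitted6 (F : fieldType) (M : 'M[F]_(3, 7)) := Permitted6 {
  coloring_of6 :> coloring6 F;
  _ : coloring_of6 \in is_permitted6 M }.

HB.instance Definition _ (F : fieldType) (M : 'M[F]_(3, 7)) :=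
  [isSub for @coloring_of6 F M].
HB.instance Definition _ (F : fieldType) (M : 'M[F]_(3, 7)) :=
  [Choice of permitted6 M by <:].
HB.instance Definition _ (F : fieldType) (M : 'M[F]_(3, 7)) :=
  [SubChoice_isSubLmodule of permitted6 M by <:].

Lemma restr_permitted (F : fieldType) (M : 'M[F]_(3, 7)) (p : 'I_7)
    (x : permitted6 M) :
  restr p x \in is_permitted5 M p.
Proof. by have /is_permitted6P[_] := valP x; apply. Qed.

Definition restriction (F : fieldType) (M : 'M[F]_(3, 7)) (p : 'I_7)
    (x : permitted6 M) : permitted5 M p :=
  Permitted5 (restr_permitted p x).

Definition edge_coloring (F : fieldType) (M : 'M[F]_(3, 7)) (i j : 'I_7) :
    coloring6 F :=
  [ffun lm : face6 =>
     let: (l, m) := val lm in minor M i l m * minor M j l m].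

Lemma minorE (F : fieldType) (M : 'M[F]_(3, 7)) i j k :
  minor M i j k =
    M 0 i * (M 1 j * M 2 k - M 2 j * M 1 k)
  - M 0 j * (M 1 i * M 2 k - M 2 i * M 1 k)
  + M 0 k * (M 1 i * M 2 j - M 2 i * M 1 j).
Proof.
rewrite /minor (expand_det_row _ 0) !big_ord_recl big_ord0 /cofactor.
rewrite !(expand_det_row _ 0) !big_ord_recl !big_ord0 /cofactor.
rewrite !det_mx11 !mxE !(tnth_nth i) /=.
have e0 : lift 0 0 = 1 :> 'I_3 by exact: val_inj.
have e1 : lift 0 (lift 0 0) = 2 :> 'I_3 by exact: val_inj.
rewrite !(e0, e1, lift0) /=.
have e2 : lift 1 0 = 0 :> 'I_3 by exact: val_inj.
have e3 : lift 2 0 = 0 :> 'I_3 by exact: val_inj.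
have e4 : lift 1 (lift 0 0) = 2 :> 'I_3 by exact: val_inj.
have e5 : lift 2 (lift 0 0) = 1 :> 'I_3 by exact: val_inj.
rewrite ?(e2, e3, e4, e5) /= /bump /=; ring.
Qed.

Lemma edge_coloring_permitted (F : fieldType) (M : 'M[F]_(3, 7))
    (hM : nonzero_minors M) (a b : 'I_7) :
  edge_coloring M a b \in is_permitted6 M.
Proof.
apply/is_permitted6P; split=> [l m lm ml|p].
  by rewrite !ffunE /= !minorE; ring.
apply/is_permitted5P => i j k l /=.
rewrite !inE !negb_or -!andbA => /and5P[ij ik il jk /andP[jl /andP[kl _]]].
rewrite !ffunE /=.
have nz (u v : face5 p) : u != v -> minor M (val u) (val v) p != 0.
  move=> uv; apply: hM; rewrite /= !inE negb_or andbT.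
  by rewrite (valP v) (valP u) !andbT; apply: contra uv => /eqP/val_inj->.
have plucker c x y z : minor M c z p * minor M x y p =
    minor M c x p * minor M z y p + minor M c y p * minor M x z p.
  by rewrite !minorE; ring.
have anti x y : minor M y x p = - minor M x y p by rewrite !minorE; ring.
have solve c (z : face5 p) : minor M c (val z) p =
    (- minor M c (val i) p * minor M (val j) (val z) p
     + minor M c (val j) p * minor M (val i) (val z) p)
      / minor M (val i) (val j) p.
  rewrite -[LHS](mulfK (nz _ _ ij)) plucker (anti (val j) (val z));
  congr (_ / _); ring.
rewrite (anti (val i) (val j)) (anti (val i) (val k)) (anti (val j) (val k)).
have := nz _ _ kl; rewrite (solve (val k) l).
rewrite (anti (val i) (val k)) (anti (val j) (val k)).
rewrite (solve a l) (solve b l) (solve a k) (solve b k).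
have := nz _ _ ij; have := nz _ _ ik; have := nz _ _ jk.
move: (minor M a _ _) (minor M a _ _) (minor M b _ _) (minor M b _ _).
move: (minor M _ _ _) (minor M _ _ _) (minor M _ _ _) (minor M _ _ _) (minor M _ _ _).
move=> c1 c2 c3 c4 c5 a1 a2 b1 b2 n1 n2 n3 n4.
by field; rewrite ?oppr_eq0 n1 n2 n3.
Qed.

Definition edge_vector (F : fieldType) (M : 'M[F]_(3, 7))
    (hM : nonzero_minors M) (i j : 'I_7) : permitted6 M :=
  Permitted6 (edge_coloring_permitted hM i j).

(* [lift p] enumerates the vertices different from p in increasing order. *)
Definition eta (F : fieldType) (M : 'M[F]_(3, 7)) (p : 'I_7) : 'M[F]_6 :=
  \matrix_(r < 6, c < 6)
    let q := lift p c in
    [:: M 0 q ^+ 2; M 1 q ^+ 2; M 2 q ^+ 2;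
        M 0 q * M 1 q; M 0 q * M 2 q; M 1 q * M 2 q]`_r.

Definition scalar5_formula (F : fieldType) (M : 'M[F]_(3, 7))
    (p i j k l : 'I_7) : F :=
  \det (eta M p) * (minor M i k p * minor M j l p + minor M i l p * minor M j k p).

(* A quadratic form on each 5-simplex is given by its polarization. *)
Definition cochain5 (F : fieldType) (M : 'M[F]_(3, 7)) :=
  forall p : 'I_7, {symmetric (permitted5 M p)}.

(* The sign attached to the ordinal p is (-1)^(p + 1), since p + 1 is the
   number of the corresponding vertex in 1, ..., 7. *)
Definition cocycle5 (F : fieldType) (M : 'M[F]_(3, 7)) (B : cochain5 M) : Prop :=
  forall x y : permitted6 M,
    \sum_(p < 7) (-1) ^+ p.+1 * B p (restriction p x) (restriction p y) = 0.

Definition is_scalar_product5 (F : fieldType) (M : 'M[F]_(3, 7))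
    (hM : nonzero_minors M) (B : cochain5 M) : Prop :=
  forall p i j k l : 'I_7, i != j -> k != l ->
    B p (restriction p (edge_vector hM i j)) (restriction p (edge_vector hM k l))
    = scalar5_formula M p i j k l.

(* Main.v *)
From HB Require Import structures.
Require Import Defs.
From mathcomp Require Import all_boot all_order all_algebra.
From mathcomp Require Import ring.
Local Open Scope ring_scope.

(** The geometry behind the proof is the following.  View the columns
    v_1, ..., v_7 of M as lines in general position in the dual projective
    plane; the 4-face lm is the intersection point of the lines l and m, given
    by the cross product of v_l and v_m.  A permitted coloring of 5-simplex p is
    the list of values of a binary quadratic form at six points of the line p:
    the permittedness condition is Lagrange interpolation through three of
    them.  A permitted coloring of the 6-simplex is the list of values of a
    ternary quadratic form at the 21 points, and the edge vector ij is the
    product of the linear forms v_i and v_j.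

    Cocycle relation.  For fixed i, j, k, l, the number
    d_ikp d_jlp + d_ilp d_jkp is a quadratic form in the column v_p, that is, a
    linear form in the column p of the 6 x 7 matrix of the six quadratic
    monomials evaluated at the v_p ([veronese]).  The matrix eta_p is this
    matrix with column p removed, so the numbers (-1)^p det eta_p are the
    coefficients of the linear relation between its seven columns given by
    Cramer's rule ([cramer_relation]).  Any linear form of the columns satisfies
    the same relation ([quadric_relation]), which is the claim for edge vectors
    ([scalar5_formula_cocycle]).

    Existence of the scalar products.  Three 4-faces of 5-simplex p give a
    Lagrange basis of the permitted colorings, made of restricted edge vectors
    ([lagrange5]).  The form is defined by bilinear extension from this basis
    ([pairing5]), and the Plucker relations show that it has the required values
    on all pairs of edges ([pairing5E]).

    From edges to all colorings.  Edge vectors span the permitted colorings of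
    every 5-simplex ([permitted5_ind]), whence uniqueness, and those of the
    6-simplex ([permitted6_ind]), whence the cocycle relation for all permitted
    colorings.  The second fact holds because a permitted coloring is determined
    by its values at the six intersection points of four of the lines
    ([permitted6_eq0]), and the six edge vectors on these four vertices form a
    Lagrange basis for these points ([lagrange6]). *)

Set Implicit Arguments.
Unset Strict Implicit.
Unset Printing Implicit Defensive.
Import GRing.Theory.

(** * Cramer's relation between the values of the quadratic monomials *)

(** Repeat row r on top of V: the resulting square matrix has two equal rows,
    and its vanishing determinant, expanded along the first row, is this sum. *)
Lemma cramer_relation (R : comNzRingType) (n : nat) (V : 'M[R]_(n, n.+1))
    (r : 'I_n) :
  \sum_(p < n.+1) (-1) ^+ p * \det (col' p V) * V r p = 0.
Proof.
pose N : 'M[R]_n.+1 := col_mx (row r V) V.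
have N0 p : N 0 p = V r p.
  have -> : 0 = @lshift 1 n 0 :> 'I_n.+1 by apply: val_inj.
  by rewrite /N (col_mxEu (row r V) V) mxE.
have Nr i p : N (lift 0 i) p = V i p.
  have -> : lift 0 i = rshift 1 i :> 'I_n.+1 by apply: val_inj.
  by rewrite /N (col_mxEd (row r V) V).
have detN : \det N = 0.
  by apply: (@determinant_alternate _ _ _ 0 (lift 0 r)) => // p; rewrite N0 Nr.
rewrite -[RHS]detN (expand_det_row _ 0); apply: eq_bigr => p _.
rewrite N0 mulrC /cofactor add0n; congr (_ * (_ * \det _)).
by apply/matrixP => i j; rewrite [LHS]mxE -Nr [RHS]mxE [RHS]mxE.
Qed.

Definition veronese (F : fieldType) (M : 'M[F]_(3, 7)) : 'M[F]_(6, 7) :=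
  \matrix_(r < 6, q < 7)
    [:: M 0 q ^+ 2; M 1 q ^+ 2; M 2 q ^+ 2;
        M 0 q * M 1 q; M 0 q * M 2 q; M 1 q * M 2 q]`_r.

Lemma eta_veronese (F : fieldType) (M : 'M[F]_(3, 7)) (p : 'I_7) :
  eta M p = col' p (veronese M).
Proof. by apply/matrixP => r c; rewrite !mxE. Qed.

Lemma quadric_relation (F : fieldType) (M : 'M[F]_(3, 7)) (c : 'I_6 -> F)
    (f : 'I_7 -> F) :
  (forall p, f p = \sum_(r < 6) c r * veronese M r p) ->
  \sum_(p < 7) (-1) ^+ p * \det (eta M p) * f p = 0.
Proof.
move=> fE.
under eq_bigr => p _.
  rewrite fE mulr_sumr eta_veronese.
  under eq_bigr => r _ do rewrite mulrCA.
  over.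
rewrite exchange_big big1 //= => r _.
by rewrite -mulr_sumr cramer_relation mulr0.
Qed.

(** A minor is linear in its last column, so the bracket in the formula is a
    quadratic form of the column p and [quadric_relation] applies. *)
Lemma scalar5_formula_cocycle (F : fieldType) (M : 'M[F]_(3, 7))
    (i j k l : 'I_7) :
  \sum_(p < 7) (-1) ^+ p.+1 * scalar5_formula M p i j k l = 0.
Proof.
(* The linear form v |-> det (column a, column b, v), and the coefficients of
   a product of two linear forms on the six monomials. *)
pose lf a b : 'I_3 -> F := fun h => [:: M 1 a * M 2 b - M 2 a * M 1 b;
   - (M 0 a * M 2 b - M 2 a * M 0 b); M 0 a * M 1 b - M 1 a * M 0 b]`_h.
pose pr (u v : 'I_3 -> F) : 'I_6 -> F := fun h =>
  [:: u 0 * v 0; u 1 * v 1; u 2 * v 2; u 0 * v 1 + u 1 * v 0;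
      u 0 * v 2 + u 2 * v 0; u 1 * v 2 + u 2 * v 1]`_h.
have lfE a b p : minor M a b p =
    lf a b 0 * M 0 p + lf a b 1 * M 1 p + lf a b 2 * M 2 p.
  by rewrite minorE /lf /=; ring.
have := @quadric_relation F M
  (fun h => - (pr (lf i k) (lf j l) h + pr (lf i l) (lf j k) h))
  (fun p => - (minor M i k p * minor M j l p + minor M i l p * minor M j k p)).
move=> rel; rewrite -[RHS]rel => [|p].
  by apply: eq_bigr => p _; rewrite /scalar5_formula exprS; ring.
rewrite !lfE !big_ord_recl big_ord0 /pr !mxE /=.
by ring.
Qed.

(** * Identities between minors *)

Lemma minorC (F : fieldType) (M : 'M[F]_(3, 7)) (i j k : 'I_7) :
  minor M j i k = - minor M i j k.
Proof. by rewrite !minorE; ring. Qed.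

Lemma minor_sort (F : fieldType) (M : 'M[F]_(3, 7)) (i j k : 'I_7) :
  ((minor M j i k = - minor M i j k) * (minor M i k j = - minor M i j k)
  * (minor M k j i = - minor M i j k) * (minor M j k i = minor M i j k)
  * (minor M k i j = minor M i j k))%type.
Proof. by rewrite !minorE; do !split; ring. Qed.

Lemma minor_alternate (F : fieldType) (M : 'M[F]_(3, 7)) (i k : 'I_7) :
  ((minor M i i k = 0) * (minor M i k i = 0) * (minor M k i i = 0))%type.
Proof. by rewrite !minorE; do !split; ring. Qed.

Lemma plucker (F : fieldType) (M : 'M[F]_(3, 7)) (a b u v p : 'I_7) :
  minor M a b p * minor M u v p =
    minor M u a p * minor M v b p - minor M u b p * minor M v a p.
Proof. by rewrite !minorE; ring. Qed.

Lemma minor_face_neq0 (F : fieldType) (M : 'M[F]_(3, 7))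
    (hM : nonzero_minors M) (p : 'I_7) (i j : face5 p) :
  i != j -> minor M (val i) (val j) p != 0.
Proof.
move=> ij; apply: hM; rewrite /= !inE negb_or andbT (valP i) (valP j) !andbT.
by rewrite (inj_eq val_inj).
Qed.

(** * Edge vectors span the permitted colorings of a 5-simplex *)

Lemma restriction_linear (F : fieldType) (M : 'M[F]_(3, 7)) (p : 'I_7) :
  linear (@restriction F M p).
Proof. by move=> a x y; apply: val_inj; apply: restr_lin. Qed.

Lemma restriction_edgeE (F : fieldType) (M : 'M[F]_(3, 7))
    (hM : nonzero_minors M) (p i j : 'I_7) (l : face5 p) :
  val (restriction p (edge_vector hM i j)) l =
    minor M i (val l) p * minor M j (val l) p.
Proof. by rewrite /= !ffunE. Qed.

(** The coefficient of the edge vector jk, which vanishes on the faces j and k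
    but not on i, in the interpolation of x through i, j and k. *)
Definition lagrange_coef (F : fieldType) (M : 'M[F]_(3, 7)) (p : 'I_7)
    (i j k : face5 p) (x : permitted5 M p) : F :=
  val x i / (minor M (val i) (val j) p * minor M (val i) (val k) p).

Lemma lagrange_coef_linear (F : fieldType) (M : 'M[F]_(3, 7)) (p : 'I_7)
    (i j k : face5 p) (a : F) (x y : permitted5 M p) :
  lagrange_coef i j k (a *: x + y) =
    a * lagrange_coef i j k x + lagrange_coef i j k y.
Proof. by rewrite /lagrange_coef linearP !ffunE /GRing.scale /=; ring. Qed.

(** On a fourth face this is the permittedness condition with inputs i, j, k;
    on an input face two of the three edge vectors vanish. *)
Lemma lagrange5 (F : fieldType) (M : 'M[F]_(3, 7)) (hM : nonzero_minors M)
    (p : 'I_7) (i j k : face5 p) (x : permitted5 M p) :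
  uniq [:: i; j; k] ->
  x = lagrange_coef i j k x *: restriction p (edge_vector hM (val j) (val k))
    + lagrange_coef j i k x *: restriction p (edge_vector hM (val i) (val k))
    + lagrange_coef k i j x *: restriction p (edge_vector hM (val i) (val j)).
Proof.
move=> u; have := u; rewrite /= !inE negb_or andbT => /andP[/andP[ij ik] jk].
apply: val_inj; apply/ffunP => l.
rewrite !(linearD, linearZ) /= !ffunE /=.
have nij := minor_face_neq0 hM ij; have nik := minor_face_neq0 hM ik.
have njk := minor_face_neq0 hM jk.
rewrite /lagrange_coef /GRing.scale /=.
have skew := (minorC M (val i) (val j), minorC M (val i) (val k),
  minorC M (val j) (val k)).
rewrite /= in nij nik njk skew.
have [->|li] := eqVneq l i.
  by rewrite !minor_alternate !skew; field; rewrite ?oppr_eq0 nij nik njk.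
have [->|lj] := eqVneq l j.
  by rewrite !minor_alternate !skew; field; rewrite ?oppr_eq0 nij nik njk.
have [->|lk] := eqVneq l k.
  by rewrite !minor_alternate !skew; field; rewrite ?oppr_eq0 nij nik njk.
have ul : uniq [:: i; j; k; l].
  rewrite -[_ :: _]/(rcons [:: i; j; k] l) rcons_uniq u !inE !negb_or.
  by rewrite li lj lk.
have /is_permitted5P/(_ _ _ _ _ ul)-> := valP x.
by rewrite /=; ring.
Qed.

Lemma lift_neq (n : nat) (h : 'I_n) (i : 'I_n.-1) : lift h i != h.
Proof. by rewrite eq_sym neq_lift. Qed.

Definition nth_face (p : 'I_7) (c : 'I_6) : face5 p :=
  exist (fun i : 'I_7 => i != p) (lift p c) (lift_neq p c).

Lemma nth_face_uniq (p : 'I_7) :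
  uniq [:: nth_face p 0; nth_face p 1; nth_face p 2].
Proof.
rewrite -[_ :: _]/(map (nth_face p) [:: 0; 1; 2]) map_inj_uniq //.
by move=> c d /(congr1 val)/lift_inj.
Qed.

(** The spanning property in the form of an induction principle.  No base case
    for 0 is asked, since 0 = (-1) e + e for any edge vector e. *)
Lemma permitted5_ind (F : fieldType) (M : 'M[F]_(3, 7))
    (hM : nonzero_minors M) (p : 'I_7) (P : permitted5 M p -> Prop) :
  (forall a x y, P x -> P y -> P (a *: x + y)) ->
  (forall i j, i != j -> P (restriction p (edge_vector hM i j))) ->
  forall x, P x.
Proof.
move=> Plin Pedge x; have u := nth_face_uniq p.
have := u; rewrite /= !inE negb_or andbT => /andP[/andP[n01 n02] n12].
pose e := restriction p
  (edge_vector hM (val (nth_face p 0)) (val (nth_face p 1))).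
have P0 : P 0.
  by rewrite -(addNr e) -scaleN1r; apply: (Plin); apply: (Pedge).
rewrite (lagrange5 hM x u) -!addrA.
do 2!(apply: (Plin); first exact: Pedge).
by rewrite -[_ *: _]addr0; apply: (Plin) => //; apply: Pedge.
Qed.

(** A binary quadratic form with three zeros vanishes. *)
Lemma permitted5_eq0 (F : fieldType) (M : 'M[F]_(3, 7))
    (hM : nonzero_minors M) (p : 'I_7) (S : {set 'I_7}) (x : permitted5 M p) :
  (2 < #|S :\ p|)%N -> (forall i : face5 p, val i \in S -> val x i = 0) ->
  x = 0.
Proof.
case/card_gt2P=> i [j] [k] [[]].
rewrite !inE => /andP[ip iS] /andP[jp jS] /andP[kp kS] [ij jk ki] x0.
pose f (l : 'I_7) (lp : l != p) : face5 p := exist (fun i => i != p) l lp.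
have u : uniq [:: f i ip; f j jp; f k kp].
  by rewrite -(map_inj_uniq val_inj) /= !inE negb_or ij jk eq_sym ki.
rewrite (lagrange5 hM x u) /lagrange_coef !x0 //.
by rewrite !mul0r !scale0r !addr0.
Qed.

(** * Edge vectors span the permitted colorings of the 6-simplex *)

(** If x vanishes at all intersection points of four lines, then each of these
    lines contains three zeros, so x vanishes on the four lines; any other line
    meets them in at least three points, so x vanishes there too. *)
Lemma permitted6_eq0 (F : fieldType) (M : 'M[F]_(3, 7))
    (hM : nonzero_minors M) (T : {set 'I_7}) (x : permitted6 M) :
  (3 < #|T|)%N ->
  (forall l m (lm : l != m), l \in T -> m \in T -> val x (mkface6 lm) = 0) ->
  x = 0.
Proof.
move=> cT x0; have /is_permitted6P[sym _] := valP x.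
have cTp p : (2 < #|T :\ p|)%N.
  by have := cT; rewrite (cardsD1 p); case: (p \in T) => //= /ltnW.
have face0 l p (lp : l != p) : restriction p x = 0 -> val x (mkface6 lp) = 0.
  move/(congr1
    (fun y : permitted5 M p => val y (exist (fun i => i != p) l lp))).
  by rewrite /= !ffunE => <-; congr (val x _); apply: val_inj.
have restr0 p : p \in T -> restriction p x = 0.
  move=> pT; apply: (permitted5_eq0 hM (cTp p)) => j jT.
  by rewrite ffunE x0.
apply: val_inj; apply/ffunP=> -[[l m] /= lm]; rewrite ffunE.
apply: (face0); apply: (permitted5_eq0 hM (cTp m)) => -[j /= jm] jT.
have mj : m != j by rewrite eq_sym.
by rewrite ffunE (sym _ _ _ mj) face0 // restr0.
Qed.

(** The coefficient of the edge vector ij in the interpolation through the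
    4-faces of four vertices, where l and m are the other two vertices. *)
Definition opposite_coef (F : fieldType) (M : 'M[F]_(3, 7)) (i j l m : 'I_7)
    (lm : l != m) (x : permitted6 M) : F :=
  val x (mkface6 lm) / (minor M i l m * minor M j l m).

(** The edge vector ij vanishes on the 4-face lm as soon as the two pairs
    meet.  So among the edges of four vertices only the opposite one is nonzero
    on a given 4-face, and both sides agree at the six faces which determine a
    permitted coloring by [permitted6_eq0]. *)
Lemma lagrange6 (F : fieldType) (M : 'M[F]_(3, 7))
    (hM : nonzero_minors M) (a b c d : 'I_7) (x : permitted6 M)
    (ab : a != b) (ac : a != c) (ad : a != d) (bc : b != c) (bd : b != d)
    (cd : c != d) :
  x = opposite_coef a b cd x *: edge_vector hM a b
    + opposite_coef a c bd x *: edge_vector hM a c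
    + opposite_coef a d bc x *: edge_vector hM a d
    + opposite_coef b c ad x *: edge_vector hM b c
    + opposite_coef b d ac x *: edge_vector hM b d
    + opposite_coef c d ab x *: edge_vector hM c d.
Proof.
apply/eqP; rewrite -subr_eq0; apply/eqP.
set y := x - _; have /is_permitted6P[sym _] := valP y.
apply: (@permitted6_eq0 _ _ hM [set v in [:: a; b; c; d]]) => [|l m lm].
  suff /card_uniqP : uniq [:: a; b; c; d] by rewrite cardsE => ->.
  by rewrite /= !inE !negb_or ab ac ad bc bd cd.
have uniq3 u v w : u != v -> u != w -> v != w -> minor M u v w != 0.
  by move=> uv uw vw; apply: (hM); rewrite /= !inE negb_or uv uw vw.
have nabc := uniq3 a b c ab ac bc.
have nabd := uniq3 a b d ab ad bd.
have nacd := uniq3 a c d ac ad cd.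
have nbcd := uniq3 b c d bc bd cd.
pose val0 u v := forall uv : u != v, val y (mkface6 uv) = 0.
have val0C u v : val0 u v -> val0 v u.
  move=> uv0 vu; have uv : u != v by rewrite eq_sym.
  by rewrite (sym _ _ vu uv).
have val0_id u : val0 u u by move=> uu; case/negP: (uu).
have sorted := (minor_sort M a b c, minor_sort M a b d, minor_sort M a c d,
  minor_sort M b c d).
have yE u v (uv : u != v) : val y (mkface6 uv) = val x (mkface6 uv)
    - (opposite_coef a b cd x * (minor M a u v * minor M b u v)
    + opposite_coef a c bd x * (minor M a u v * minor M c u v)
    + opposite_coef a d bc x * (minor M a u v * minor M d u v)
    + opposite_coef b c ad x * (minor M b u v * minor M c u v)
    + opposite_coef b d ac x * (minor M b u v * minor M d u v)
    + opposite_coef c d ab x * (minor M c u v * minor M d u v)).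
  by rewrite !ffunE.
have [v_ab v_ac v_ad [v_bc v_bd v_cd]] :
    [/\ val0 a b, val0 a c, val0 a d & [/\ val0 b c, val0 b d & val0 c d]].
  do ![split] => uv;
    [have -> := eq_irrelevance uv ab | have -> := eq_irrelevance uv ac
    | have -> := eq_irrelevance uv ad | have -> := eq_irrelevance uv bc
    | have -> := eq_irrelevance uv bd | have -> := eq_irrelevance uv cd];
  rewrite yE /opposite_coef !(minor_alternate, sorted);
  by field; rewrite ?oppr_eq0 nabc nabd nacd nbcd.
move=> lT mT; move: lm; change (val0 l m); move: lT mT.
rewrite !inE => /or4P[]/eqP-> /or4P[]/eqP->;
  first [exact (val0_id _) | assumption | refine (val0C _ _ _); assumption].
Qed.

Lemma permitted6_ind (F : fieldType) (M : 'M[F]_(3, 7))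
    (hM : nonzero_minors M) (P : permitted6 M -> Prop) :
  (forall a x y, P x -> P y -> P (a *: x + y)) ->
  (forall i j, i != j -> P (edge_vector hM i j)) ->
  forall x, P x.
Proof.
move=> Plin Pedge x.
have [e01 e02 e03] :
  [/\ 0 != 1 :> 'I_7, 0 != 2 :> 'I_7 & 0 != 3 :> 'I_7] by [].
have [e12 e13 e23] :
  [/\ 1 != 2 :> 'I_7, 1 != 3 :> 'I_7 & 2 != 3 :> 'I_7] by [].
have P0 : P 0.
  rewrite -(addNr (edge_vector hM 0 1)) -scaleN1r.
  by apply: (Plin); apply: (Pedge).
rewrite (lagrange6 hM x e01 e02 e03 e12 e13 e23) -!addrA.
do 5!(apply: (Plin); first exact: Pedge).
by rewrite -[_ *: _]addr0; apply: (Plin) => //; apply: Pedge.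
Qed.

(** * The scalar product of permitted colorings of a 5-simplex *)

Lemma scalar5_formulaC (F : fieldType) (M : 'M[F]_(3, 7))
    (p i j k l : 'I_7) :
  scalar5_formula M p i j k l = scalar5_formula M p k l i j.
Proof.
rewrite /scalar5_formula (minorC M i k) (minorC M j l) (minorC M j k).
by rewrite (minorC M i l); ring.
Qed.

(** The pairing of x with the edge vector uv, by linear extension of the
    formula from the Lagrange basis of the faces i, j, k. *)
Definition pairing5_edge (F : fieldType) (M : 'M[F]_(3, 7)) (p : 'I_7)
    (i j k : face5 p) (x : permitted5 M p) (u v : 'I_7) : F :=
  lagrange_coef i j k x * scalar5_formula M p (val j) (val k) u v
  + lagrange_coef j i k x * scalar5_formula M p (val i) (val k) u v
  + lagrange_coef k i j x * scalar5_formula M p (val i) (val j) u v.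

Definition pairing5 (F : fieldType) (M : 'M[F]_(3, 7)) (p : 'I_7)
    (i j k : face5 p) (x y : permitted5 M p) : F :=
  lagrange_coef i j k y * pairing5_edge i j k x (val j) (val k)
  + lagrange_coef j i k y * pairing5_edge i j k x (val i) (val k)
  + lagrange_coef k i j y * pairing5_edge i j k x (val i) (val j).

Lemma pairing5C (F : fieldType) (M : 'M[F]_(3, 7)) (p : 'I_7)
    (i j k : face5 p) (x y : permitted5 M p) :
  pairing5 i j k x y = pairing5 i j k y x.
Proof.
rewrite /pairing5 /pairing5_edge.
rewrite (scalar5_formulaC M p (val i) (val k) (val j) (val k)).
rewrite (scalar5_formulaC M p (val i) (val j) (val j) (val k)).
rewrite (scalar5_formulaC M p (val i) (val j) (val i) (val k)).
by ring.
Qed.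

Lemma pairing5_bilinear (F : fieldType) (M : 'M[F]_(3, 7)) (p : 'I_7)
    (i j k : face5 p) :
  bilinear_for
    (GRing.Scale.Law.clone _ _ *%R _) (GRing.Scale.Law.clone _ _ *%R _)
    (pairing5 i j k : permitted5 M p -> permitted5 M p -> F).
Proof.
have lin y a x x' : pairing5 i j k (a *: x + x') y =
    a * pairing5 i j k x y + pairing5 i j k x' y :> F.
  by rewrite /pairing5 /pairing5_edge !lagrange_coef_linear; ring.
split=> [y|y] a x x' /=; first exact: lin.
by rewrite !(pairing5C i j k y) lin.
Qed.

HB.instance Definition _ (F : fieldType) (M : 'M[F]_(3, 7)) (p : 'I_7)
    (i j k : face5 p) :=
  bilinear_isBilinear.Build F (permitted5 M p) (permitted5 M p) F _ _
    (pairing5 i j k) (pairing5_bilinear M i j k).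

Lemma pairing5_hermitian (F : fieldType) (M : 'M[F]_(3, 7)) (p : 'I_7)
    (i j k : face5 p) (x y : permitted5 M p) :
  pairing5 i j k x y = (-1) ^+ false * idfun (pairing5 i j k y x).
Proof. by rewrite mul1r pairing5C. Qed.

HB.instance Definition _ (F : fieldType) (M : 'M[F]_(3, 7)) (p : 'I_7)
    (i j k : face5 p) :=
  isHermitianSesquilinear.Build F (permitted5 M p) false idfun
    (pairing5 i j k) (@pairing5_hermitian F M p i j k).

(** The formula depends on the edge ab only through the product of the linear
    forms d_a.p and d_b.p, so it is compatible with the expansion of that
    product in a Lagrange basis. *)
Lemma pairing5_edgeE (F : fieldType) (M : 'M[F]_(3, 7))
    (hM : nonzero_minors M) (p : 'I_7) (i j k : face5 p) (a b u v : 'I_7) :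
  uniq [:: i; j; k] ->
  pairing5_edge i j k (restriction p (edge_vector hM a b)) u v =
    scalar5_formula M p a b u v.
Proof.
rewrite /= !inE negb_or andbT => /andP[/andP[ij ik] jk].
have nij := minor_face_neq0 hM ij; have nik := minor_face_neq0 hM ik.
have njk := minor_face_neq0 hM jk.
rewrite /pairing5_edge /lagrange_coef !restriction_edgeE /scalar5_formula.
set A := \det _.
move: nij nik njk.
move: (val i) (val j) (val k) => {ij ik jk}{}i {}j {}k nij nik njk.
(* By the Plucker relation all minors with last column p are expressed through
   the coordinates d_zip and d_zjp of the columns z; in these independent
   coordinates the claim is an identity of rational functions. *)
have E y z : minor M y z p =
    (minor M y i p * minor M z j p - minor M y j p * minor M z i p)
      / minor M i j p.
  by rewrite -plucker mulrAC mulfV // mul1r.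
rewrite (minorC M k i) (minorC M k j) oppr_eq0 in nik njk *.
rewrite oppr_eq0 in njk.
rewrite (E a k) (E b k) (E k u) (E k v) (E a u) (E a v) (E b u) (E b v).
rewrite (minorC M u i) (minorC M v i) (minorC M u j) (minorC M v j).
rewrite (minorC M i j).
by field; rewrite ?oppr_eq0 nij nik njk.
Qed.

Lemma pairing5E (F : fieldType) (M : 'M[F]_(3, 7)) (hM : nonzero_minors M)
    (p : 'I_7) (i j k : face5 p) (a b c d : 'I_7) :
  uniq [:: i; j; k] ->
  pairing5 i j k (restriction p (edge_vector hM a b))
    (restriction p (edge_vector hM c d)) = scalar5_formula M p a b c d.
Proof.
move=> u; rewrite /pairing5 !pairing5_edgeE // (scalar5_formulaC M p a b c d).
rewrite -(pairing5_edgeE hM c d a b u) /pairing5_edge.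
by rewrite !(scalar5_formulaC M p a b).
Qed.

(** Any three faces would do; by [scalar_product5_unique] the form does not
    depend on them. *)
Definition scalar5 (F : fieldType) (M : 'M[F]_(3, 7)) : cochain5 M :=
  fun p => pairing5 (nth_face p 0) (nth_face p 1) (nth_face p 2).

Lemma scalar_product5_unique (F : fieldType) (M : 'M[F]_(3, 7))
    (hM : nonzero_minors M) (B B' : cochain5 M) :
  is_scalar_product5 hM B -> is_scalar_product5 hM B' ->
  forall (p : 'I_7) (x y : permitted5 M p), B' p x y = B p x y.
Proof.
move=> BE B'E p x y.
elim/(@permitted5_ind _ _ hM): x => [a x x' IHx IHx'|i j ij].
  by rewrite !linearPl /= IHx IHx'.
elim/(@permitted5_ind _ _ hM): y => [a y y' IHy IHy'|k l kl].
  by rewrite !linearPr /= IHy IHy'.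
by rewrite BE // B'E.
Qed.

(** * The cocycle condition *)

Lemma cochain5_sum_linear (F : fieldType) (M : 'M[F]_(3, 7)) (B : cochain5 M)
    (a : F) (x x' y : permitted6 M) :
  \sum_(p < 7) (-1) ^+ p.+1 *
      B p (restriction p (a *: x + x')) (restriction p y) =
    a * (\sum_(p < 7) (-1) ^+ p.+1 * B p (restriction p x) (restriction p y))
    + \sum_(p < 7) (-1) ^+ p.+1 * B p (restriction p x') (restriction p y).
Proof.
rewrite mulr_sumr -big_split; apply: eq_bigr => p _.
by rewrite restriction_linear linearPl /=; ring.
Qed.

Lemma cochain5C (F : fieldType) (M : 'M[F]_(3, 7)) (B : cochain5 M)
    (p : 'I_7) (x y : permitted5 M p) : B p x y = B p y x.
Proof. by rewrite hermC expr0 mul1r. Qed.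

Lemma cocycle5_edges (F : fieldType) (M : 'M[F]_(3, 7))
    (hM : nonzero_minors M) (B : cochain5 M) :
  (forall i j k l : 'I_7, i != j -> k != l ->
     \sum_(p < 7) (-1) ^+ p.+1 *
       B p (restriction p (edge_vector hM i j))
           (restriction p (edge_vector hM k l)) = 0) ->
  cocycle5 B.
Proof.
move=> Bedge x y.
elim/(@permitted6_ind _ _ hM): x => [a x x' IHx IHx'|i j ij].
  by rewrite cochain5_sum_linear IHx IHx' mulr0 addr0.
under eq_bigr do rewrite cochain5C.
elim/(@permitted6_ind _ _ hM): y => [a y y' IHy IHy'|k l kl].
  by rewrite cochain5_sum_linear IHy IHy' mulr0 addr0.
exact: Bedge.
Qed.

Theorem proposition4 (F : fieldType) (char_ne2 : 2%N \notin [pchar F])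
    (M : 'M[F]_(3, 7)) (hM : nonzero_minors M) :
  exists B : cochain5 M,
    [/\ is_scalar_product5 hM B,
        forall B' : cochain5 M, is_scalar_product5 hM B' ->
          forall (p : 'I_7) (x y : permitted5 M p), B' p x y = B p x y,
        cocycle5 B
      & forall i j k l : 'I_7, i != j -> k != l ->
          \sum_(p < 7) (-1) ^+ p.+1 *
            B p (restriction p (edge_vector hM i j))
                (restriction p (edge_vector hM k l)) = 0].
Proof.
have BE : is_scalar_product5 hM (scalar5 M).
  by move=> p i j k l _ _; apply/pairing5E/nth_face_uniq.
have Bedge (i j k l : 'I_7) : i != j -> k != l ->
    \sum_(p < 7) (-1) ^+ p.+1 *
      scalar5 M p (restriction p (edge_vector hM i j))
                  (restriction p (edge_vector hM k l)) = 0.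
  move=> ij kl; rewrite -[RHS](scalar5_formula_cocycle M i j k l).
  by apply: eq_bigr => p _; rewrite BE.
exists (scalar5 M); split=> //; last exact: cocycle5_edges Bedge.
by move=> B' B'E; apply: scalar_product5_unique.
Qed.
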